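(* Consider a stable matching instance with one-sided uncertainty and a stable matching $M$. In the set query model, the minimum number of set queries needed to verify that $M$ is stable equals $|\{b \in B \mid \exists a \in A \colon b \prec_a M(a)\}|$, which is at most $n$. Further, there is a $1$-competitive algorithm to verify that $M$ is stable.
   Context: Two disjoint sets $A$, $B$ of agents with $|A|=|B|=n$. Each $a\in A$ has a strict total order $\prec_a$ on $B$ and each $b\in B$ has a strict total order $\prec_b$ on $A$; $x\prec_y z$ means $y$ prefers $x$ to $z$. A matching is a bijection between $A$ and $B$; it is stable if there is no pair $(a,b)$, $b\neq M(a)$, with $a$ preferring $b$ to $M(a)$ and $b$ preferring $a$ to $M(b)$. One-sided uncertainty: the orders $\prec_a$ ($a\in A$) are known, the orders $\prec_b$ ($b\in B$) are unknown and learned only via queries. A set query $\mathit{top}(b,S)$ for $b\in B$ and $S\subseteq A$ returns $b$'s most preferred element of $S$. A query set verifies stability if $M$ is stable for every $B$-side preference profile consistent with the answers. An algorithm is $\rho$-competitive if its number of queries is at most $\rho$ times this minimum; the ratio is measured only on inputs where $M$ is stable. *)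

(* Defs.v *)
From HB Require Import structures.
From mathcomp Require Import all_boot all_order all_algebra.

Set Implicit Arguments.
Unset Strict Implicit.
Unset Printing Implicit Defensive.

Import Order.TTheory GRing.Theory Num.Theory.

(* [r x z] means that [x] is preferred to [z]. *)
Record strict_order (T : finType) := StrictOrder {
  so_rel :> rel T;
  so_irr : irreflexive so_rel;
  so_trans : transitive so_rel;
  so_connex : forall x z, x != z -> so_rel x z || so_rel z x
}.

(* The two sides are indexed by separate types, so they are disjoint even if A = B;
   [profile A B] gives every agent of A an order on B. *)
Definition profile (A B : finType) := A -> strict_order B.

Record matching (A B : finType) := Matching {
  mateA :> A -> B;
  mateB : B -> A;
  mateAK : cancel mateA mateB;
  mateBK : cancel mateB mateA
}.

Section Model.
Variables A B : finType.
Implicit Types (PA : profile A B) (PB : profile B A) (M : matching A B).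

Definition blocking PA PB M (a : A) (b : B) : bool :=
  [&& b != M a, PA a b (M a) & PB b a (mateB M b)].

Definition stable PA PB M : Prop := ~ exists a b, blocking PA PB M a b.

Definition query : finType := (B * {set A})%type.

(* [None] is returned only for the (uninformative) query of the empty set. *)
Definition top PB (q : query) : option A :=
  [pick a in q.2 | [forall c in q.2, (c != a) ==> PB q.1 a c]].

Definition consistent PB (Q : {set query}) PB' : Prop :=
  forall q, q \in Q -> top PB' q = top PB q.

(* [PB] is the true profile, which determines the answers to [Q]. *)
Definition verifies PA PB M (Q : {set query}) : Prop :=
  forall PB', consistent PB Q PB' -> stable PA PB' M.

Definition min_queries PA PB M (k : nat) : Prop :=
  (exists2 Q : {set query}, verifies PA PB M Q & #|Q| = k) /\
  (forall Q : {set query}, verifies PA PB M Q -> k <= #|Q|).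

(* A deterministic adaptive query strategy: a well-founded (hence always
   terminating) decision tree that learns the B-side orders only through the
   answers, and stops by declaring the matching stable or not. *)
Inductive strategy : Type :=
| Stop (verdict : bool)
| Ask (q : query) (next : option A -> strategy).

Fixpoint verdict PB (s : strategy) : bool :=
  match s with
  | Stop v => v
  | Ask q next => verdict PB (next (top PB q))
  end.

Fixpoint asked PB (s : strategy) : seq query :=
  match s with
  | Stop _ => [::]
  | Ask q next => q :: asked PB (next (top PB q))
  end.

End Model.

(* The input available to an algorithm is the A-side profile and the matching. *)
Definition algorithm : Type :=
  forall A B : finType, profile A B -> matching A B -> strategy A B.

(* A positive verdict must be justified by the answers received; since
   [verifies] entails stability for the true profile, the verdict is positive
   exactly when the matching is stable. *)
Definition verification_algorithm (alg : algorithm) : Prop :=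
  forall (A B : finType) (PA : profile A B) (PB : profile B A)
         (M : matching A B),
    if verdict PB (alg A B PA M)
    then verifies PA PB M [set q in asked PB (alg A B PA M)]
    else ~ stable PA PB M.

(* Repeated queries are counted with multiplicity. *)
Definition competitive (rho : rat) (alg : algorithm) : Prop :=
  forall (A B : finType) (PA : profile A B) (PB : profile B A)
         (M : matching A B),
    stable PA PB M ->
    exists2 k : nat, min_queries PA PB M k &
      ((size (asked PB (alg A B PA M)))%:R <= rho * k%:R)%R.

(* Main.v *)
(** For each [b] that some agent prefers to its own partner, ask for the top of
    the set made of the partner of [b] and of these suitors.  The matching is
    stable iff the answer is always the partner, so these queries suffice.
    Conversely, a [b] with a suitor about which nothing was asked may rank that
    suitor first, so at least one query per such [b] is needed. *)
Require Import Defs.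
From HB Require Import structures.
From mathcomp Require Import all_boot all_order all_algebra.

Set Implicit Arguments.
Unset Strict Implicit.
Unset Printing Implicit Defensive.

Section Verification.
Variables A B : finType.
Implicit Types (PA : profile A B) (PB : profile B A) (M : matching A B).

Definition suitors PA M (b : B) : {set A} := [set a | PA a b (M a)].

Definition courted PA M : {set B} := [set b | [exists a, PA a b (M a)]].

Definition suitor_query PA M (b : B) : query A B :=
  (b, mateB M b |: suitors PA M b).

Lemma so_asym (T : finType) (r : strict_order T) (x z : T) :
  r x z -> r z x -> False.
Proof. by move=> rxz /(so_trans rxz); rewrite so_irr. Qed.

Lemma top_eqP PB (b : B) (S : {set A}) (a : A) : a \in S ->
  reflect {in S, forall c, c != a -> PB b a c} (top PB (b, S) == Some a).
Proof.
move=> aS; apply: (iffP eqP); rewrite /top /=.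
  case: pickP => // x /andP[_ /forallP topx] [<-] c cS ca.
  by have := topx c; rewrite cS ca.
move=> topa; case: pickP => [x /andP[xS /forallP topx]|/(_ a)].
  (* Any [x] that [pick] returns is itself on top, and two distinct top elements would each beat the
     other. *)
  case: (eqVneq x a) => [-> //|xa].
  have := topx a; rewrite aS eq_sym xa /= => pxa.
  by case: (so_asym pxa (topa x xS xa)).
rewrite /= aS; suff -> : [forall c in S, (c != a) ==> PB b a c] by [].
by apply/forall_inP => c cS; apply/implyP => /(topa c cS).
Qed.

(** The blocking pairs at [b] come from the suitors that [b] ranks above its partner, so there are
    none exactly when the partner tops the queried set. Outside [courted] there are no suitors,
    hence no blocking pairs. *)
Lemma stable_topP PA PB M :
  stable PA PB M <->
  {in courted PA M, forall b, top PB (suitor_query PA M b) == Some (mateB M b)}.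
Proof.
split=> [stM b _|topM [a [b /and3P[bM ab ba]]]].
  apply/top_eqP; first exact: setU11.
  move=> c; rewrite in_setU1 inE => /orP[/eqP-> /eqP //|cb cM].
  have /orP[bc|//] := so_connex (PB b) cM.
  case: stM; exists c, b; rewrite /blocking cb bc !andbT.
  by apply: contraNneq cM => ->; rewrite mateAK.
have bD : b \in courted PA M by rewrite inE; apply/existsP; exists a.
have am : a != mateB M b by apply: contraNneq bM => ->; rewrite mateBK.
have /top_eqP topb := topM b bD.
apply: (so_asym ba); apply: topb am; first exact: setU11.
by rewrite in_setU1 inE ab orbT.
Qed.

(** The criterion of [stable_topP] reads the B-side profile only through these answers, which every
    consistent profile shares. *)
Lemma verifies_suitor_query PA PB M (Q : {set query A B}) :
  stable PA PB M ->
  {in courted PA M, forall b, suitor_query PA M b \in Q} ->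
  verifies PA PB M Q.
Proof.
move=> /stable_topP topM sDQ PB' PBQ; apply/stable_topP => b bD.
by rewrite PBQ ?sDQ ?topM.
Qed.

Section Promote.
Variables (T : finType) (a : T) (r : strict_order T).

(** The adversary's change of an order in the lower bound: [a] goes first and the others keep their
    relative order. *)
Definition promote_rel : rel T :=
  fun x z => (z != a) && ((x == a) || r x z).

Lemma promote_irr : irreflexive promote_rel.
Proof. by move=> x; rewrite /promote_rel so_irr orbF andNb. Qed.

Lemma promote_trans : transitive promote_rel.
Proof.
move=> y x z /andP[ya /orP[xa|xy]] /andP[za yz]; rewrite /promote_rel za ?xa //.
by move: yz; rewrite (negPf ya) => /(so_trans xy) ->; rewrite orbT.
Qed.

Lemma promote_connex x z : x != z -> promote_rel x z || promote_rel z x.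
Proof.
rewrite /promote_rel; case: (eqVneq x a) => [->|xa] /=.
  by rewrite eq_sym => ->.
by case: (eqVneq z a) => //= _ /so_connex.
Qed.

Definition promote : strict_order T :=
  StrictOrder promote_irr promote_trans promote_connex.

End Promote.

Lemma verifies_queried PA PB M (Q : {set query A B}) :
  verifies PA PB M Q -> courted PA M \subset [set q.1 | q in Q].
Proof.
move=> verQ; apply/subsetP => b; rewrite inE => /existsP[a ab].
apply/negPn/negP => bQ.
(* Only the order of [b] is altered, and no query of [Q] concerns [b], so every answer survives
   while the suitor [a] now blocks with [b]. *)
pose PB' : profile B A := fun c => if c == b then promote a (PB c) else PB c.
have PBQ : consistent PB Q PB'.
  move=> q qQ; rewrite /top /PB'; case: eqP => // qb.
  by case/imsetP: bQ; exists q.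
have bM : b != M a by apply: contraTneq ab => ->; rewrite so_irr.
case: (verQ PB' PBQ); exists a, b; rewrite /blocking bM ab /PB' eqxx /=.
by rewrite /promote_rel eqxx andbT; apply: contraNneq bM => <-; rewrite mateBK.
Qed.

Lemma min_queries_courted PA PB M :
  stable PA PB M -> min_queries PA PB M #|courted PA M|.
Proof.
move=> stM; split=> [|Q /verifies_queried sDQ].
  exists [set suitor_query PA M b | b in courted PA M].
    by apply: verifies_suitor_query => // b bD; apply: imset_f.
  by rewrite card_imset // => b c [].
(* Each query concerns a single agent of [B], so covering [courted] takes at least one query per
   member. *)
exact: leq_trans (subset_leq_card sDQ) (leq_imset_card _ _).
Qed.

(** Stopping early is sound: an answer other than the partner is a suitor that forms a blocking pair
    with [b]. *)
Fixpoint check_suitors PA M (s : seq B) : strategy A B :=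
  if s is b :: s' then
    Ask (suitor_query PA M b) (fun ans =>
      if ans == Some (mateB M b) then check_suitors PA M s' else Stop A B false)
  else Stop A B true.

Lemma verdict_check_suitors PA PB M (s : seq B) :
  verdict PB (check_suitors PA M s) =
  all (fun b => top PB (suitor_query PA M b) == Some (mateB M b)) s.
Proof. by elim: s => //= b s <-; case: ifP. Qed.

(** A positive verdict rules out an early stop. *)
Lemma asked_check_suitors PA PB M (s : seq B) :
  verdict PB (check_suitors PA M s) ->
  asked PB (check_suitors PA M s) = map (suitor_query PA M) s.
Proof. by elim: s => //= b s IHs; case: ifP => // _ /IHs ->. Qed.

Lemma size_asked_check_suitors PA PB M (s : seq B) :
  size (asked PB (check_suitors PA M s)) <= size s.
Proof. by elim: s => //= b s IHs; case: ifP. Qed.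

End Verification.

Theorem theorem21 :
  (forall (n : nat) (A B : finType) (hA : #|A| = n) (hB : #|B| = n)
          (PA : profile A B) (PB : profile B A) (M : matching A B),
     stable PA PB M ->
     min_queries PA PB M #|[set b : B | [exists a : A, PA a b (M a)]]| /\
     #|[set b : B | [exists a : A, PA a b (M a)]]| <= n) /\
  (exists alg : algorithm, verification_algorithm alg /\ competitive 1%R alg).
Proof.
split=> [n A B _ <- PA PB M stM|].
  by split; [apply: min_queries_courted | apply: max_card].
(* [enum] lists each courted agent once, so at most [#|courted PA M|] queries are asked, which is
   the minimum when the matching is stable. *)
exists (fun A B PA M => check_suitors PA M (enum (courted PA M))).
split=> A B PA PB M; last first.
  move=> stM; exists #|courted PA M|; first exact: min_queries_courted.
  by rewrite GRing.mul1r Num.Theory.ler_nat cardE size_asked_check_suitors.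
case: ifP => [ok|/negbT nok].
  have stM : stable PA PB M.
    apply/stable_topP => b bD; move: ok; rewrite verdict_check_suitors.
    by move/allP; apply; rewrite mem_enum.
  apply: verifies_suitor_query => // b bD.
  by rewrite inE asked_check_suitors // map_f // mem_enum.
move=> /stable_topP topM; case/negP: nok; rewrite verdict_check_suitors.
by apply/allP => b; rewrite mem_enum => /topM.
Qed.
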